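(* Let $(X_t)_{t\ge0}$ be a time-homogeneous continuous-time Markov process with countable state space $S$ (transition rates not assumed symmetric), let $i\in S$, and suppose $p_t(i,i)\sim ct^{-\alpha}$ as $t\to\infty$ for some $c,\alpha>0$. Let $L_t=\int_0^t\mathbf 1_{\{X_s=i\}}\,ds$ for the process started in $i$. Let $\kappa>0$ and $\kappa<\frac1{G_\infty}$. Then, as $t\to\infty$, $$\mathbb{E}[e^{\kappa L_t}]\sim\frac{1}{1-\kappa G_\infty}.$$
   Context: $p_t(i,j)=\mathbb{P}[X_t=j\mid X_0=i]$; the process is a (conservative) continuous-time Markov chain with right-continuous paths. $G_\infty=\int_0^\infty p_t(i,i)\,dt\in(0,\infty]$ (with $1/\infty=0$). $h_1\sim h_2$ means $\lim h_1/h_2=1$. *)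

(* Defs.v *)
From HB Require Import structures.
From mathcomp Require Import all_boot all_order all_algebra.
From mathcomp Require Import all_classical all_reals all_analysis.

Set Implicit Arguments.
Unset Strict Implicit.
Unset Printing Implicit Defensive.

Import Order.TTheory GRing.Theory Num.Theory.
Import numFieldTopology.Exports numFieldNormedType.Exports.

Local Open Scope classical_set_scope.
Local Open Scope ring_scope.

(* A time-homogeneous Markov chain is a process X on a measurable space together
   with one probability measure P j for each starting state j.  Times are real
   numbers; only the values X t with 0 <= t matter. *)

Definition transition_prob (R : realType) (d : measure_display)
    (Omega : measurableType d) (S : countType)
    (P : S -> probability Omega R) (X : R -> Omega -> S)
    (t : R) (j k : S) : R :=
  fine (P j [set w | X t w = k]).

(* In ctmc_markov the finite list h prescribes states at finitely many times of
   [0, s].  X takes its values in S at every time, so the transition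
   probabilities out of each state sum to 1; ctmc_right_continuous is right
   continuity for the discrete topology on S. *)
Record is_ctmc (R : realType) (d : measure_display)
    (Omega : measurableType d) (S : countType)
    (P : S -> probability Omega R) (X : R -> Omega -> S) : Prop := {
  ctmc_measurable : forall (t : R) (k : S), 0 <= t ->
    measurable [set w | X t w = k];
  ctmc_start : forall j : S, P j [set w | X 0 w = j] = 1%E;
  ctmc_markov : forall (j k l : S) (s t : R) (h : seq (R * S)),
    0 <= s -> 0 <= t -> (forall u, u \in h -> 0 <= u.1 <= s) ->
    let past := [set w | forall u, u \in h -> X u.1 w = u.2] in
    (P j (past `&` [set w | X s w = k] `&` [set w | X (s + t)%R w = l]) =
     P j (past `&` [set w | X s w = k]) * (transition_prob P X t k l)%:E)%E;
  ctmc_right_continuous : forall (w : Omega) (t : R), 0 <= t ->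
    \forall s \near t^'+, X s w = X t w
}.

Definition green (R : realType) (d : measure_display)
    (Omega : measurableType d) (S : countType)
    (P : S -> probability Omega R) (X : R -> Omega -> S) (i : S) : \bar R :=
  (\int[lebesgue_measure]_(t in `[0%R, +oo[) (transition_prob P X t i i)%:E)%E.

Definition local_time (R : realType) (d : measure_display)
    (Omega : measurableType d) (S : countType)
    (X : R -> Omega -> S) (i : S) (t : R) (w : Omega) : R :=
  Rintegral lebesgue_measure `[0, t] \1_[set s : R | X s w = i].

Definition asymp_equiv (R : realType) (f g : R -> R) : Prop :=
  f t / g t @[t --> +oo] --> (1 : R).

(* Main.v *)
(* Write a_j for the indicator of X (j h) = i and theta = e^(kappa h) - 1, so
   that exp(kappa h (a_1 + ... + a_m)) = prod_(j <= m) (1 + theta a_j).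
   Telescoping, its expectation is v_m = 1 + theta (y_1 + ... + y_m) with
   y_l = E[prod_(j < l) (1 + theta a_j) a_l], and the Markov property gives the
   renewal equation y_l = p_l + theta sum_(r < l) y_r p_(l - r), where
   p_l = p_(l h)(i, i).  Hence, with P_n = p_1 + ... + p_n,
   v_n <= 1 + theta P_n v_n and 1 + theta P_n v_n <= v_(2 n).  Taking h = t / n
   and n -> oo (right-continuous Riemann sums), u(t) = E[exp(kappa L_t)] and
   G_t = int_0^t p_s(i, i) ds satisfy
   u(t) <= 1 + kappa G_t u(t) <= u(2 t).
   As u is nondecreasing and bounded by 1 / (1 - kappa G), its limit U satisfies
   U = 1 + kappa G U. *)

Require Import Defs.
From HB Require Import structures.
From mathcomp Require Import all_boot all_order all_algebra.
From mathcomp Require Import all_classical all_reals all_analysis.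
From mathcomp Require Import measurable_realfun lra ring.

Set Implicit Arguments.
Unset Strict Implicit.
Unset Printing Implicit Defensive.

Import Order.TTheory GRing.Theory Num.Theory.
Import numFieldTopology.Exports numFieldNormedType.Exports.

Local Open Scope classical_set_scope.
Local Open Scope ring_scope.

(** * Integrals of bounded functions on sets of finite measure *)

Lemma bounded_integrable (d : measure_display) (T : measurableType d)
    (R : realType) (mu : {measure set T -> \bar R}) (D : set T) (f : T -> R)
    (M : R) :
  measurable D -> (mu D < +oo)%E -> measurable_fun D f ->
  (forall x, D x -> `|f x| <= M) -> mu.-integrable D (EFin \o f).
Proof.
move=> mD muD mf fM; apply: measurable_bounded_integrable => //.
exists M; split; first exact: num_real.
by move=> y My x Dx; exact: le_trans (fM _ Dx) (ltW My).
Qed.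

Lemma bounded_convergence (d : measure_display) (T : measurableType d)
    (R : realType) (mu : {measure set T -> \bar R}) (D : set T)
    (f_ : nat -> T -> R) (f : T -> R) (M : R) :
  measurable D -> (mu D < +oo)%E -> (forall n, measurable_fun D (f_ n)) ->
  (forall n x, D x -> `|f_ n x| <= M) ->
  (forall x, D x -> f_ n x @[n --> \oo] --> f x) ->
  Rintegral mu D (f_ n) @[n --> \oo] --> Rintegral mu D f.
Proof.
move=> mD muD mf_ f_M f_f.
have mf : measurable_fun D f by exact: measurable_fun_cvg f_f.
have [|||||? _ /=] := @dominated_convergence _ _ _ mu D mD
  (fun n x => (f_ n x)%:E) (EFin \o f) (cst M%:E).
- by move=> n; exact/measurable_EFinP.
- exact/measurable_EFinP.
- by apply: aeW => x Dx; apply: cvg_EFin; [exact: nearW|exact: f_f].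
- exact: (@bounded_integrable _ _ _ _ _ (cst M) `|M|).
- by apply: aeW => x n Dx; rewrite lee_fin f_M.
move=> cv; apply: fine_cvg; rewrite fineK ?cv//.
exact: integrable_fin_num.
Qed.

Lemma Rintegral_sum (d : measure_display) (T : measurableType d)
    (R : realType) (mu : {measure set T -> \bar R}) (D : set T) (I : Type)
    (r : seq I) (F : I -> T -> R) :
  measurable D -> (forall i, mu.-integrable D (EFin \o F i)) ->
  Rintegral mu D (fun x => \sum_(i <- r) F i x) =
  \sum_(i <- r) Rintegral mu D (F i).
Proof.
move=> mD iF; elim: r => [|i r IH].
  by rewrite big_nil; under eq_Rintegral do rewrite big_nil;
     rewrite Rintegral_cst// mul0r.
rewrite big_cons -IH -RintegralD//.
  by under eq_Rintegral do rewrite big_cons.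
rewrite (_ : EFin \o _ = fun x => (\sum_(j <- r) (F j x)%:E)%E).
  by apply: integrable_sum => // j _; exact: iF.
by apply/funext => x /=; rewrite sumEFin.
Qed.

Lemma lebesgue_measure_bounded_itv_lty (R : realType) (x y : bool) (a b : R) :
  (lebesgue_measure [set` Interval (BSide x a) (BSide y b)] < +oo)%E.
Proof.
by rewrite lebesgue_measure_itv/=; case: ifPn => // _; rewrite -EFinB ltry.
Qed.

(** * Right-endpoint Riemann sums of right-continuous functions *)

Section riemann.
Context {R : realType}.
Implicit Types (f : R -> R) (T h r M : R).

(* Each cell is sampled at its right end point: this is what makes the sums
   converge when f is only right-continuous. *)
Let step f h (m : nat) (r : R) : R :=
  \sum_(j < m) f (h * j.+1%:R) * \1_(`[h * j%:R, h * j.+1%:R[%classic) r.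

(** The cells are disjoint and the one containing [r] has index [truncn (r / h)], so a single
    summand survives. *)
Let stepE f h (m : nat) r : 0 < h -> 0 <= r < h * m%:R ->
  step f h m r = f (h * (Num.truncn (r / h)).+1%:R).
Proof.
move=> h0 /andP[r0 rm].
have /truncn_itv /andP[tr1 tr2] : 0 <= r / h by rewrite divr_ge0// ltW.
have tm : (Num.truncn (r / h) < m)%N.
  rewrite truncn_lt_nat ?divr_ge0 ?(ltW h0)//.
  by rewrite ltr_pdivrMr// mulrC.
rewrite /step (bigD1 (Ordinal tm))//= big1 ?addr0.
  rewrite indicE mem_set ?mulr1//= in_itv/=; apply/andP; split.
    by rewrite mulrC -ler_pdivlMr.
  by rewrite mulrC -ltr_pdivrMr.
move=> j jt; rewrite indicE memNset ?mulr0//= in_itv/= => /andP[jr rj].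
move/eqP: jt; apply; apply/val_inj => /=; apply/esym/truncn_def.
by rewrite ler_pdivlMr// ltr_pdivrMr// mulrC jr mulrC rj.
Qed.

Let measurable_step f h m D : measurable_fun D (step f h m).
Proof.
apply: measurable_sum => j; apply: measurable_funM => //.
Qed.

(** The sample point [a n] lies strictly to the right of [r] and within one mesh of it, so right
    continuity at [r] suffices. *)
Let step_cvg f T r : 0 < T -> 0 <= r < T -> f x @[x --> r^'+] --> f r ->
  step f (T / n.+1%:R) n.+1 r @[n --> \oo] --> f r.
Proof.
move=> T0 /andP[r0 rT] fr.
have h0 n : 0 < T / n.+1%:R by rewrite divr_gt0.
under eq_fun.
  move=> n; rewrite stepE//; last by rewrite divfK// r0.
  over.
pose a n := T / n.+1%:R * (Num.truncn (r / (T / n.+1%:R))).+1%:R.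
have ha n : r < a n <= r + T / n.+1%:R.
  have /truncn_itv /andP[t1 t2] : 0 <= r / (T / n.+1%:R).
    by rewrite divr_ge0// ltW.
  rewrite /a; apply/andP; split; first by rewrite mulrC -ltr_pdivrMr.
  rewrite -[(Num.truncn _).+1%:R]natr1 mulrDr mulr1 lerD2r mulrC.
  by rewrite -ler_pdivlMr.
move/cvg_at_rightP: fr; apply; split; first by move=> n; have /andP[] := ha n.
apply: (@squeeze_cvgr _ _ _ _ (fun=> r) (fun n => r + T / n.+1%:R)).
- by apply: nearW => n; have /andP[/ltW -> ->] := ha n.
- exact: cvg_cst.
- rewrite -[X in _ --> X]addr0; apply: cvgD; first exact: cvg_cst.
  rewrite -(mulr0 T); apply: cvgM; first exact: cvg_cst.
  exact: cvg_harmonic.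
Qed.

Lemma right_continuous_measurable f T :
  (forall r, 0 <= r -> f x @[x --> r^'+] --> f r) ->
  measurable_fun `[0, T] f.
Proof.
(* The longer interval has positive length whatever the sign of [T], and it keeps [T] away from its
   right end, where the step functions vanish. On it [f] is a pointwise limit of step functions. *)
move=> fr; have T1 : 0 < `|T| + 1 by rewrite ltr_pwDr.
apply: (@measurable_funS _ _ _ _ `[0, `|T| + 1[) => //.
  move=> r /=; rewrite !in_itv/= => /andP[-> rT] /=.
  by rewrite (le_lt_trans rT)// (le_lt_trans (ler_norm _))// ltrDl.
apply: (@measurable_fun_cvg _ _ _ _
  (fun n => step f ((`|T| + 1) / n.+1%:R) n.+1)).
  by move=> n; exact: measurable_step.
move=> r /=; rewrite in_itv/= => r0T; apply: step_cvg => //.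
by apply: fr; case/andP: r0T.
Qed.

Let Rintegral_step f T n M : 0 < T -> (forall r, 0 <= r -> `|f r| <= M) ->
  Rintegral lebesgue_measure `[0, T[ (step f (T / n.+1%:R) n.+1) =
  \sum_(j < n.+1) f (T / n.+1%:R * j.+1%:R) * (T / n.+1%:R).
Proof.
move=> T0 fM; set h := T / n.+1%:R.
have h0 : 0 < h by rewrite divr_gt0.
have ind (j : 'I_n.+1) : lebesgue_measure.-integrable `[0, T[
    (EFin \o \1_(`[h * j%:R, h * j.+1%:R[%classic)).
  apply: (@integrableS _ _ _ _ setT) => //.
  exact: (integrable_indic_itv _ _ true true).
rewrite /step Rintegral_sum//; last first.
  move=> j; rewrite (_ : EFin \o _ = (fun r => (f (h * j.+1%:R)%R)%:E *
    (EFin \o \1_(`[(h * j%:R)%R, (h * j.+1%:R)%R[%classic)) r)%E).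
    by apply: integrableZl => //; exact: ind.
  by apply/funext.
apply: eq_bigr => j _.
rewrite RintegralZl; [|exact: measurable_itv|exact: (ind j)].
congr (_ * _).
rewrite /Rintegral integral_indic; [|exact: measurable_itv..].
rewrite setIidl.
  apply: etrans (congr1 fine (lebesgue_measure_itv _)) _.
  rewrite /= lte_fin ltr_pM2l// ltr_nat ltnSn.
  by rewrite -EFinB/= -mulrBr -natrB// subSnn mulr1.
move=> r /=; rewrite !in_itv/= => /andP[jr rj].
apply/andP; split; first by rewrite (le_trans _ jr)// mulr_ge0// ltW.
apply: lt_le_trans rj _; have -> : T = h * n.+1%:R by rewrite divfK.
by rewrite ler_pM2l// ler_nat ltn_ord.
Qed.

Lemma right_riemann_sum_cvg f T M : 0 < T ->
  (forall r, 0 <= r -> `|f r| <= M) ->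
  (forall r, 0 <= r -> f x @[x --> r^'+] --> f r) ->
  T / n.+1%:R * \sum_(j < n.+1) f (T / n.+1%:R * j.+1%:R) @[n --> \oo]
    --> Rintegral lebesgue_measure `[0, T] f.
Proof.
move=> T0 fM fr.
(* The cells are open on the right, so the step functions vanish at [T] and need not converge there;
   this null point is removed first. *)
rewrite -Rintegral_itv_bndo_bndc; last first.
  apply: (@bounded_integrable _ _ _ _ _ _ M) => //.
  - exact: lebesgue_measure_bounded_itv_lty.
  - have mf := right_continuous_measurable (T := T) fr.
    apply: measurable_funS mf => //.
    by move=> r /=; rewrite !in_itv/= => /andP[-> /ltW ->].
  - by move=> r /=; rewrite in_itv/= => /andP[r0 _]; exact: fM.
under eq_fun.
  move=> n; rewrite mulrC mulr_suml -(Rintegral_step n T0 fM).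
  over.
apply: (@bounded_convergence _ _ _ _ _ _ _ M) => //.
- exact: lebesgue_measure_bounded_itv_lty.
- by move=> n; exact: measurable_step.
- move=> n r /=; rewrite in_itv/= => /andP[r0 rT].
  have h0 : 0 < T / n.+1%:R by rewrite divr_gt0.
  rewrite stepE// ?divfK ?r0//; apply: fM.
  by rewrite mulr_ge0// ltW.
- move=> r /=; rewrite in_itv/= => r0T; apply: step_cvg => //.
  by apply: fr; case/andP: r0T.
Qed.

End riemann.

(** * Inequalities for partial sums of a discrete renewal equation *)

Section renewal.
Context {R : realDomainType}.
Variables (theta : R) (y p : nat -> R).
Hypotheses (theta_ge0 : 0 <= theta) (y_ge0 : forall l, 0 <= y l)
  (p_ge0 : forall l, 0 <= p l).
(** Indices start at zero: [y l] and [p l] are y_(l+1) and p_(l+1) of the overview, which turns p_(l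
    - r) into [p (l - r.+1)]. *)
Hypothesis renewal : forall l,
  y l = p l + theta * \sum_(r < l) y r * p (l - r.+1)%N.

Let ler_psum m n : (m <= n)%N -> \sum_(k < m) p k <= \sum_(k < n) p k.
Proof.
move=> mn; rewrite -(subnKC mn) big_split_ord/= lerDl.
by apply: sumr_ge0.
Qed.

(** Exchanging the double sum collects, for each [r], the values of [p] at the lags that fit below
    [m]. *)
Let sum_renewal m : \sum_(l < m) y l =
  \sum_(l < m) p l + theta * \sum_(r < m) y r * \sum_(k < m - r.+1) p k.
Proof.
elim: m => [|m IH]; first by rewrite !big_ord0 mulr0 addr0.
rewrite !big_ord_recr/= subnn big_ord0 mulr0 addr0.
rewrite [X in _ + theta * X](eq_bigr (fun r : 'I_m =>
  y r * (\sum_(k < m - r.+1) p k) + y r * p (m - r.+1)%N)); last first.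
  move=> r _; rewrite -mulrDr; congr (_ * _).
  by rewrite subSn ?ltn_ord// big_ord_recr.
rewrite big_split/= mulrDr IH renewal; ring.
Qed.

(** This is v_m of the overview. *)
Let S (m : nat) := 1 + theta * \sum_(l < m) y l.

(** Every inner sum of [p] is enlarged to the full sum over [k < m], which then factors out. *)
Lemma renewal_upper m : S m <= 1 + theta * (\sum_(k < m) p k) * S m.
Proof.
rewrite {1}/S lerD2l -mulrA ler_wpM2l// sum_renewal mulrDr mulr1 lerD2l.
rewrite mulrCA ler_wpM2l// mulr_sumr; apply: ler_sum => r _.
by rewrite mulrC ler_wpM2r// ler_psum// leq_subr.
Qed.

(** Of the [n + n] terms only those with [r < n] are kept; their inner sums still have at least [n]
    terms. *)
Lemma renewal_lower n :
  1 + theta * (\sum_(k < n) p k) * S n <= S (n + n)%N.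
Proof.
rewrite [leRHS]/S lerD2l -mulrA ler_wpM2l// sum_renewal mulrDr mulr1 lerD//.
  by rewrite ler_psum// leq_addr.
rewrite mulrCA ler_wpM2l// mulr_sumr big_split_ord/= -[leLHS]addr0 lerD//.
  apply: ler_sum => r _; rewrite mulrC ler_wpM2l// ler_psum//.
  by rewrite -addnBA ?ltn_ord// leq_addr.
by apply: sumr_ge0 => r _; rewrite mulr_ge0// sumr_ge0.
Qed.

End renewal.

(** * The chain sampled at multiples of [h], and its renewal equation *)

Section skeleton.
Context {R : realType} {d : measure_display} {Omega : measurableType d}
  {S : countType} (P : S -> probability Omega R) (X : R -> Omega -> S).
Hypothesis HX : is_ctmc P X.
Variable i : S.
Implicit Types (f g : Omega -> R) (u s t : R).

(** This class is closed under sums and products, so it settles every integrability condition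
    below. *)
Let bmeas f := measurable_fun setT f /\ exists M : R, forall w, `|f w| <= M.

Let bmeas_int f : bmeas f -> (P i).-integrable setT (EFin \o f).
Proof.
move=> [mf [M fM]]; apply: (@bounded_integrable _ _ _ _ _ _ M) => //.
exact: le_lt_trans (probability_le1 (P i) measurableT) (ltry 1).
Qed.

Let bmeas_cst (c : R) : bmeas (cst c).
Proof. by split => //; exists `|c|. Qed.

Let bmeasM f g : bmeas f -> bmeas g -> bmeas (fun w => f w * g w).
Proof.
move=> [mf [M fM]] [mg [N gN]]; split; first exact: measurable_funM.
by exists (M * N) => w; rewrite normrM ler_pM.
Qed.

Let bmeasD f g : bmeas f -> bmeas g -> bmeas (fun w => f w + g w).
Proof.
move=> [mf [M fM]] [mg [N gN]]; split; first exact: measurable_funD.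
by exists (M + N) => w; rewrite (le_trans (ler_normD _ _))// lerD.
Qed.

Definition visit u : Omega -> R := \1_[set w | X u w = i].

Let visit_bmeas u : 0 <= u -> bmeas (visit u).
Proof.
move=> u0; split.
  by apply: measurable_indic; exact: ctmc_measurable HX _ _ u0.
exists 1 => w; rewrite /visit indicE.
by case: (_ \in _); rewrite ?normr1 ?normr0.
Qed.

Let visit_ge0 u w : 0 <= visit u w.
Proof. by rewrite /visit indicE. Qed.

Let p t := transition_prob P X t i i.

Let E f := Rintegral (P i) setT f.

Let E_visit t : 0 <= t -> E (visit t) = p t.
Proof.
move=> t0; rewrite /E /Rintegral integral_indic//; first by rewrite setIT.
exact: ctmc_measurable HX _ _ t0.
Qed.

(** Times are paired with [i] so that the event has the shape used in [ctmc_markov]. *)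
Let past (us : seq R) :=
  [set w | forall u : R * S, u \in [seq (v, i) | v <- us] -> X u.1 w = u.2].

Let pastE us : past us = [set w | forall u, u \in us -> X u w = i].
Proof.
apply/seteqP; split => w /= H.
  by move=> u uus; apply: (H (u, i)); apply/mapP; exists u.
by move=> _ /mapP[u uus ->] /=; exact: H.
Qed.

Let past_cons u us : past (u :: us) = [set w | X u w = i] `&` past us.
Proof.
rewrite !pastE; apply/seteqP; split => w /=.
  by move=> H; split=> [|v vus]; apply: H; rewrite inE ?eqxx// vus orbT.
by move=> [uw H] v; rewrite inE => /predU1P[->|/H].
Qed.

Let past_meas us : (forall u, u \in us -> 0 <= u) -> measurable (past us).
Proof.
elim: us => [_|u us IH us0].
  rewrite (_ : past [::] = setT)//.
  by rewrite pastE; apply/seteqP; split.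
rewrite past_cons; apply: measurableI.
  by apply: (ctmc_measurable HX); apply: us0; rewrite mem_head.
by apply: IH => v vus; apply: us0; rewrite inE vus orbT.
Qed.

Variable theta : R.
Hypothesis theta_ge0 : 0 <= theta.

Let W (us : seq R) w := \prod_(u <- us) (1 + theta * visit u w).

Let W_bmeas us : (forall u, u \in us -> 0 <= u) -> bmeas (W us).
Proof.
elim: us => [_|u us IH us0].
  rewrite (_ : W [::] = cst 1); first exact: bmeas_cst.
  by apply/funext => w; rewrite /W big_nil.
rewrite (_ : W _ = fun w => (1 + theta * visit u w) * W us w).
  apply: bmeasM; last by apply: IH => v vus; apply: us0; rewrite inE vus orbT.
  apply: (bmeasD (bmeas_cst 1)); apply: (bmeasM (bmeas_cst theta)).
  by apply: visit_bmeas; apply: us0; rewrite mem_head.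
by apply/funext => w; rewrite /W big_cons.
Qed.

(* Expanding the product reduces the Markov property for the weight W, which
   depends on the whole past, to finite-dimensional events. *)
Let weighted_markov vs us s t : 0 <= s -> 0 <= t ->
  (forall u, u \in vs ++ us -> 0 <= u <= s) ->
  E (fun w => \1_(past vs) w * W us w * visit s w * visit (s + t) w) =
  E (fun w => \1_(past vs) w * W us w * visit s w) * p t.
Proof.
move=> s0 t0; elim: us vs => [vs|u us IH vs] us_s.
  rewrite cats0 in us_s.
  have mvs : measurable (past vs).
    by apply: past_meas => u /us_s/andP[].
  have ms := ctmc_measurable HX i s0.
  have mst := ctmc_measurable HX i (addr_ge0 s0 t0).
  rewrite (_ : (fun w => _) = \1_(past vs `&` [set w | X s w = i] `&`
    [set w | X (s + t) w = i])); last first.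
    by apply/funext => w; rewrite /W big_nil mulr1 !indicI.
  rewrite [in RHS](_ : (fun w => _) =
    \1_(past vs `&` [set w | X s w = i])); last first.
    by apply/funext => w; rewrite /W big_nil mulr1 !indicI.
  rewrite /E /Rintegral !integral_indic//; try (by repeat apply: measurableI).
  rewrite !setIT.
  have vs_s (u : R * S) : u \in [seq (v, i) | v <- vs] -> 0 <= u.1 <= s.
    by move=> /mapP[v vvs ->] /=; exact: us_s.
  apply: etrans (congr1 fine (ctmc_markov HX i i i s0 t0 vs_s)) _.
  by rewrite fineM// fin_num_measure//; exact: measurableI.
have /andP[u0 _] : 0 <= u <= s by apply: us_s; rewrite mem_cat mem_head orbT.
have vsus0 v : v \in vs ++ us -> 0 <= v <= s.
  move=> vin; apply: us_s; move: vin; rewrite !mem_cat inE.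
  by case/orP => ->; rewrite ?orbT.
have uvsus0 v : v \in (u :: vs) ++ us -> 0 <= v <= s.
  move=> vin; apply: us_s; move: vin; rewrite /= inE !mem_cat inE.
  by case/or3P => ->; rewrite ?orbT.
pose Q vs w := \1_(past vs) w * W us w * visit s w.
have bQ vs' : (forall v, v \in vs' ++ us -> 0 <= v <= s) -> bmeas (Q vs').
  move=> H; apply: bmeasM; last exact: visit_bmeas.
  apply: bmeasM; last first.
    apply: W_bmeas => v vus.
    by have /andP[] : 0 <= v <= s by apply: H; rewrite mem_cat vus orbT.
  split.
    apply: measurable_indic; apply: past_meas => v vvs.
    by have /andP[] : 0 <= v <= s by apply: H; rewrite mem_cat vvs.
  by exists 1 => w; rewrite indicE; case: (_ \in _); rewrite ?normr1 ?normr0.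
(* The factor of [u] contributes either 1, leaving [vs] as it is, or [theta] times a visit at [u],
   which moves [u] into the prescribed past. *)
have WE w : \1_(past vs) w * W (u :: us) w * visit s w =
    Q vs w + theta * Q (u :: vs) w.
  have -> : Q (u :: vs) w = visit u w * Q vs w.
    by rewrite /Q past_cons indicI/= -!mulrA.
  by rewrite /Q /W big_cons; ring.
have bst : bmeas (visit (s + t)) by apply: visit_bmeas; rewrite addr_ge0.
have -> : E (fun w => \1_(past vs) w * W (u :: us) w * visit s w) =
    E (Q vs) + theta * E (Q (u :: vs)).
  rewrite /E -RintegralZl//; last by apply: bmeas_int; exact: bQ.
  rewrite -RintegralD//; first by apply: eq_Rintegral => w _; exact: WE.
    by apply: bmeas_int; exact: bQ.
  by apply: bmeas_int; apply: (bmeasM (bmeas_cst theta)); exact: bQ.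
rewrite mulrDl -mulrA -(IH vs)// -(IH (u :: vs))//.
have bQst vs' : (forall v, v \in vs' ++ us -> 0 <= v <= s) ->
    bmeas (fun w => Q vs' w * visit (s + t) w).
  by move=> H; apply: bmeasM => //; exact: bQ.
rewrite /E -RintegralZl//; last by apply: bmeas_int; exact: bQst.
rewrite -RintegralD//.
- by apply: eq_Rintegral => w _; rewrite WE /Q; ring.
- by apply: bmeas_int; exact: bQst.
- by apply: bmeas_int; apply: (bmeasM (bmeas_cst theta)); exact: bQst.
Qed.

Variable h : R.
Hypothesis h_gt0 : 0 < h.

(** Sampling starts at [h], not at 0, in agreement with the right end points of the Riemann
    cells. *)
Let T (j : nat) := h * j.+1%:R.
Let T_ge0 j : 0 <= T j. Proof. by rewrite /T mulr_ge0// ltW. Qed.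
Let V (l : nat) w := \prod_(j < l) (1 + theta * visit (T j) w).
Let y l := E (fun w => V l w * visit (T l) w).

Let VE l : V l = W [seq T j | j <- iota 0 l].
Proof.
apply/funext => w; rewrite /V /W big_map.
by rewrite -[l in iota 0 l]subn0 -/(index_iota 0 l) big_mkord.
Qed.

Let V_bmeas l : bmeas (V l).
Proof. by rewrite VE; apply: W_bmeas => _ /mapP[j _ ->]. Qed.

Let V_ge0 l w : 0 <= V l w.
Proof. by apply: prodr_ge0 => j _; rewrite addr_ge0// mulr_ge0. Qed.

(** Telescoping: passing from [V j] to [V j.+1] adds [theta * V j * visit (T j)]. *)
Let V_expand l w :
  V l w = 1 + theta * \sum_(j < l) V j w * visit (T j) w.
Proof.
elim: l => [|l IH]; first by rewrite /V !big_ord0 mulr0 addr0.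
rewrite /V !big_ord_recr/= -/(V l w) {1}IH.
set s := \sum_(_ < _) _.
have -> : (1 + theta * s) = V l w by rewrite IH.
rewrite [in RHS]mulrDr addrA -IH; ring.
Qed.

(** The weighted Markov property at time [T r] with empty prescribed past; the remaining time
    [T l - T r] is [T (l - r.+1)]. *)
Let V_markov r l : (r < l)%N ->
  E (fun w => V r w * visit (T r) w * visit (T l) w) = y r * p (T (l - r.+1)%N).
Proof.
move=> rl; have Tl : T l = T r + T (l - r.+1)%N.
  by rewrite /T -mulrDr -natrD addnS subnKC.
have := @weighted_markov [::] [seq T j | j <- iota 0 r] (T r) (T (l - r.+1)%N).
rewrite -VE -Tl.
have -> : past [::] = setT by rewrite pastE; apply/seteqP; split.
rewrite indicT => WM; apply: etrans (etrans _ (WM _ _ _)) _ => //.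
- by apply: eq_Rintegral => w _; rewrite mul1r.
- move=> _ /mapP[j + ->]; rewrite mem_iota add0n/= => jr.
  by rewrite T_ge0/= /T ler_pM2l// ler_nat ltnW.
- by congr (_ * _); apply: eq_Rintegral => w _; rewrite mul1r.
Qed.

(** Used twice: [f] the visit at [T l] gives the renewal equation, and [f = 1] gives the expectation
    of [V l]. *)
Let V_visit_sum l f : bmeas f ->
  E (fun w => V l w * f w) =
  E f + theta * \sum_(j < l) E (fun w => V j w * visit (T j) w * f w).
Proof.
move=> bf.
have b j : bmeas (fun w => V j w * visit (T j) w * f w).
  by apply: (bmeasM _ bf); apply: bmeasM => //; exact: visit_bmeas.
have bs : bmeas (fun w => \sum_(j < l) V j w * visit (T j) w * f w).
  elim: (index_enum _) => [|j r IH].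
    by under eq_fun do rewrite big_nil; exact: bmeas_cst.
  by under eq_fun do rewrite big_cons; exact: bmeasD.
rewrite /E -Rintegral_sum//; last by move=> j; exact: bmeas_int.
rewrite -RintegralZl//; last exact: bmeas_int.
rewrite -RintegralD//; [|exact: bmeas_int|]; last first.
  by apply: bmeas_int; exact: (bmeasM (bmeas_cst theta)).
apply: eq_Rintegral => w _; rewrite V_expand mulrDl mul1r -mulrA mulr_suml.
by [].
Qed.

Let y_renewal l :
  y l = p (T l) + theta * \sum_(r < l) y r * p (T (l - r.+1)%N).
Proof.
rewrite {1}/y V_visit_sum ?E_visit//; last exact: visit_bmeas.
by congr (_ + _ * _); apply: eq_bigr => r _; rewrite V_markov.
Qed.

Let E_V m : E (V m) = 1 + theta * \sum_(l < m) y l.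
Proof.
transitivity (E (fun w => V m w * cst 1 w)).
  by apply: eq_Rintegral => w _; rewrite mulr1.
rewrite V_visit_sum; last exact: bmeas_cst.
congr (_ + _ * _).
  rewrite /E Rintegral_cst// mul1r.
  exact: etrans (congr1 fine (probability_setT (P i))) _.
by apply: eq_bigr => l _; apply: eq_Rintegral => w _; rewrite mulr1.
Qed.

Let y_ge0 l : 0 <= y l.
Proof. by apply: Rintegral_ge0 => w _; rewrite mulr_ge0. Qed.

Let p_ge0 l : 0 <= p (T l).
Proof. by rewrite fine_ge0. Qed.

Lemma skeleton_upper m :
  E (V m) <= 1 + theta * (\sum_(k < m) p (T k)) * E (V m).
Proof.
by rewrite E_V; exact: (renewal_upper theta_ge0 y_ge0 p_ge0 y_renewal).
Qed.

Lemma skeleton_lower n :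
  1 + theta * (\sum_(k < n) p (T k)) * E (V n) <= E (V (n + n)%N).
Proof.
by rewrite !E_V; exact: (renewal_lower theta_ge0 y_ge0 p_ge0 y_renewal).
Qed.

End skeleton.

(** * Regularity of the local time and of the return probability *)

Section occupation.
Context {R : realType} {d : measure_display} {Omega : measurableType d}
  {S : countType} (P : S -> probability Omega R) (X : R -> Omega -> S).
Hypothesis HX : is_ctmc P X.
Variable i : S.
Implicit Types (s t r : R) (w : Omega).

Let L t w := local_time X i t w.

Let visit_itv t w : 0 <= visit X i t w <= 1.
Proof. by rewrite /visit indicE; case: (_ \in _); rewrite ?lexx ?ler01. Qed.

Let visitE w : \1_[set s : R | X s w = i] = (fun s : R => visit X i s w).
Proof. by apply/funext => s; rewrite /visit !indicE. Qed.

Let normr_visit t w : `|visit X i t w| <= 1.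
Proof. by have /andP[v0 v1] := visit_itv t w; rewrite ger0_norm. Qed.

Let visit_rc w r : 0 <= r -> visit X i x w @[x --> r^'+] --> visit X i r w.
Proof.
move=> r0; apply: cvg_near_cst.
apply: filterS (ctmc_right_continuous HX w r0) => s Xs.
rewrite /visit !indicE; congr ((nat_of_bool _)%:R).
by apply/idP/idP; rewrite !inE/= Xs.
Qed.

Let visit_int w t :
  (@lebesgue_measure R).-integrable `[0, t] (EFin \o visit X i ^~ w).
Proof.
apply: (@bounded_integrable _ _ _ _ _ _ 1) => //.
  exact: lebesgue_measure_bounded_itv_lty.
by apply: right_continuous_measurable => r; exact: visit_rc.
Qed.

Let L_le t w : L t w <= `|t|.
Proof.
rewrite /L /local_time visitE.
apply: (@le_trans _ _ (Rintegral (@lebesgue_measure R) `[0, t] (cst 1))).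
  apply: le_Rintegral => //.
    apply: (@bounded_integrable _ _ _ _ _ _ 1) => //=.
      exact: lebesgue_measure_bounded_itv_lty.
    by move=> r _; rewrite normr1.
  by move=> s _; have /andP[] := visit_itv s w.
rewrite Rintegral_cst// mul1r.
suff : fine (lebesgue_measure `[0, t]) <= `|t| by [].
rewrite lebesgue_measure_itv/=; case: ifPn => //= t0.
by rewrite subr0 ler_norm.
Qed.

Let L_nondecreasing w : {homo L ^~ w : s t / s <= t}.
Proof.
move=> s t st; rewrite /L /local_time visitE.
have subst : `[0, s] `<=` `[0, t].
  by move=> r /=; rewrite !in_itv/= => /andP[-> rs]; rewrite (le_trans rs).
apply: fine_le.
- by apply: integrable_fin_num => //; exact: visit_int.
- by apply: integrable_fin_num => //; exact: visit_int.
apply: ge0_subset_integral => //.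
  by have /integrableP[] := visit_int w t.
by move=> r _; rewrite lee_fin; have /andP[] := visit_itv r w.
Qed.

Let L_npos t w : t <= 0 -> L t w = 0.
Proof.
rewrite le_eqVlt => /predU1P[->|t0]; rewrite /L /local_time.
  by rewrite set_itv1 Rintegral_set1.
by rewrite set_itv_ge ?Rintegral_set0// -leNgt bnd_simp.
Qed.

Let L_cvg t w : 0 < t ->
  t / n.+1%:R * \sum_(j < n.+1) visit X i (t / n.+1%:R * j.+1%:R) w
    @[n --> \oo] --> L t w.
Proof.
move=> t0; rewrite /L /local_time visitE.
apply: (right_riemann_sum_cvg (M := 1)) => // r r0; exact: visit_rc.
Qed.

(** For [t > 0] the local time is a pointwise limit of Riemann sums, each depending on finitely many
    coordinates of the process. *)
Let L_meas t : measurable_fun setT (L t).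
Proof.
have [t0|t0] := ltP 0 t; last first.
  rewrite (_ : L t = cst 0); first exact: measurable_cst.
  by apply/funext => w; exact: L_npos.
apply: (@measurable_fun_cvg _ _ _ _ (fun n w => t / n.+1%:R *
  \sum_(j < n.+1) visit X i (t / n.+1%:R * j.+1%:R) w)); last first.
  by move=> w _; exact: L_cvg.
move=> n; apply: measurable_funM => //; apply: measurable_sum => j.
apply: measurable_indic; apply: (ctmc_measurable HX).
by rewrite mulr_ge0// divr_ge0// ltW.
Qed.

(** Visit indicators are right-continuous along each path; bounded convergence carries this over to
    their expectations. *)
Lemma transition_prob_right_continuous r : 0 <= r ->
  transition_prob P X x i i @[x --> r^'+] --> transition_prob P X r i i.
Proof.
move=> r0.
have pE t : 0 <= t ->
    transition_prob P X t i i = Rintegral (P i) setT (visit X i t).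
  move=> t0; rewrite /Rintegral integral_indic// ?setIT//.
  exact: (ctmc_measurable HX).
apply/cvg_at_rightP => v [rv vr].
have v0 n : 0 <= v n by rewrite (le_trans r0)// ltW.
rewrite pE//; under eq_fun do rewrite pE//.
apply: (@bounded_convergence _ _ _ _ _ _ _ 1) => //.
- exact: le_lt_trans (probability_le1 (P i) measurableT) (ltry 1).
- by move=> n; apply: measurable_indic; exact: (ctmc_measurable HX).
- by move=> w _; have /cvg_at_rightP := @visit_rc w r r0; exact.
Qed.

Let p t := transition_prob P X t i i.

Let p_le1 t : 0 <= t -> `|p t| <= 1.
Proof.
move=> t0; have mt := ctmc_measurable HX i t0.
rewrite ger0_norm ?fine_ge0// -lee_fin fineK ?fin_num_measure//.
exact: probability_le1.
Qed.

(** * Bounds on the exponential moment as the mesh vanishes *)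

Variable kappa : R.
Hypothesis kappa_gt0 : 0 < kappa.

Let u t := Rintegral (P i) setT (fun w => expR (kappa * L t w)).

Let exp_meas t : measurable_fun setT (fun w => expR (kappa * L t w)).
Proof. by apply: measurableT_comp => //; apply: measurable_funM. Qed.

Let exp_int t :
  (P i).-integrable setT (EFin \o (fun w => expR (kappa * L t w))).
Proof.
apply: (@bounded_integrable _ _ _ _ _ _ (expR (kappa * `|t|))) => //.
  exact: le_lt_trans (probability_le1 (P i) measurableT) (ltry 1).
by move=> w _; rewrite ger0_norm ?expR_ge0// ler_expR ler_pM2l.
Qed.

Let u_ge0 t : 0 <= u t.
Proof. by apply: Rintegral_ge0 => w _; exact: expR_ge0. Qed.

Let u_nondecreasing : {homo u : s t / s <= t}.
Proof.
move=> s t st.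
apply: le_Rintegral; [exact: measurableT|exact: exp_int..|] => w _.
by rewrite ler_expR ler_pM2l// L_nondecreasing.
Qed.

(** The skeleton expectation of [V m] for [theta = expR (kappa * h) - 1]. *)
Let v h (m : nat) := Rintegral (P i) setT (fun w =>
  \prod_(j < m) (1 + (expR (kappa * h) - 1) * visit X i (h * j.+1%:R) w)).

(** A visit is 0 or 1, so each factor equals [expR (kappa * h * visit)]. *)
Let prod_exp h m w :
  \prod_(j < m) (1 + (expR (kappa * h) - 1) * visit X i (h * j.+1%:R) w) =
  expR (kappa * (h * \sum_(j < m) visit X i (h * j.+1%:R) w)).
Proof.
elim: m => [|m IH]; first by rewrite !big_ord0 !mulr0 expR0.
rewrite !big_ord_recr/= IH [in RHS]mulrDr [in RHS]mulrDr expRD; congr (_ * _).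
rewrite /visit indicE; case: (_ \in _); rewrite ?mulr0 ?mulr1 ?expR0 ?addr0//.
by rewrite subrKC.
Qed.

Let v_cvg t : 0 < t -> v (t / n.+1%:R) n.+1 @[n --> \oo] --> u t.
Proof.
move=> t0.
have h0 n : 0 < t / n.+1%:R by rewrite divr_gt0.
rewrite /v; under eq_fun do under eq_Rintegral do rewrite prod_exp.
apply: (@bounded_convergence _ _ _ _ _ _ _ (expR (kappa * t))) => //.
- exact: le_lt_trans (probability_le1 (P i) measurableT) (ltry 1).
- move=> n; apply: measurableT_comp => //; apply: measurable_funM => //.
  apply: measurable_funM => //; apply: measurable_sum => j.
  apply: measurable_indic; apply: (ctmc_measurable HX).
  by rewrite mulr_ge0// ltW.
- move=> n w _; rewrite ger0_norm ?expR_ge0// ler_expR ler_pM2l//.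
  rewrite -[leRHS](divfK (_ : n.+1%:R != 0 :> R))// ler_pM2l//.
  rewrite -[X in _ <= X%:R]card_ord -sum1_card natr_sum; apply: ler_sum => j _.
  by have /andP[] := visit_itv (t / n.+1%:R * j.+1%:R) w.
- move=> w _; apply: continuous_cvg; first exact: continuous_expR.
  by apply: cvgM; [exact: cvg_cst|exact: L_cvg].
Qed.

Let G t := Rintegral (@lebesgue_measure R) `[0, t] p.

Let G_cvg t : 0 < t ->
  t / n.+1%:R * \sum_(j < n.+1) p (t / n.+1%:R * j.+1%:R) @[n --> \oo] --> G t.
Proof.
move=> t0; apply: (right_riemann_sum_cvg (M := 1)) => // r r0.
exact: transition_prob_right_continuous.
Qed.

(** Compares theta with [kappa * h]: the upper bound exceeds the lower one by a factor that tends to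
    1 as [h] tends to 0. *)
Let theta_bounds h : 0 < h ->
  kappa * h <= expR (kappa * h) - 1 <= kappa * expR (kappa * h) * h.
Proof.
move=> h0; apply/andP; split.
  by have := expR_ge1Dx (kappa * h); lra.
(* Multiplying 1 - x <= e^(-x) by e^x gives e^x - 1 <= x e^x. *)
have := expR_ge1Dx (- (kappa * h)).
rewrite expRN -(ler_pM2r (expR_gt0 (kappa * h))) mulVf ?gt_eqF ?expR_gt0//.
by rewrite mulrDl mul1r; lra.
Qed.

Let sum_ge0 h m : 0 <= \sum_(k < m) p (h * k.+1%:R).
Proof. by apply: sumr_ge0 => k _; rewrite fine_ge0. Qed.

Let v_ge0 h m : 0 <= v h m.
Proof. by apply: Rintegral_ge0 => w _; rewrite prod_exp expR_ge0. Qed.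

Let u_upper t : 0 < t -> u t <= 1 + kappa * G t * u t.
Proof.
move=> t0.
have h0 n : 0 < t / n.+1%:R by rewrite divr_gt0.
pose rhs n := 1 + kappa * expR (kappa * (t / n.+1%:R)) *
  (t / n.+1%:R * \sum_(j < n.+1) p (t / n.+1%:R * j.+1%:R)) *
  v (t / n.+1%:R) n.+1.
apply: (ler_cvg_to (v_cvg t0) (_ : rhs n @[n --> \oo] --> _)).
  apply: cvgD; first exact: cvg_cst.
  apply: cvgM; last exact: v_cvg.
  apply: cvgM; last exact: G_cvg.
  (* The limit is written with [t * 0] so that the product and continuity rules match it factor by
     factor. *)
  suff : kappa * expR (kappa * (t / n.+1%:R)) @[n --> \oo] -->
      kappa * expR (kappa * (t * 0)) by rewrite !mulr0 expR0 mulr1.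
  apply: cvgM; first exact: cvg_cst.
  apply: continuous_cvg; first exact: continuous_expR.
  apply: cvgM; first exact: cvg_cst.
  by apply: cvgM; [exact: cvg_cst|exact: cvg_harmonic].
apply: nearW => n; have /andP[k1 k2] := theta_bounds (h0 n).
have th0 : 0 <= expR (kappa * (t / n.+1%:R)) - 1.
  by apply: le_trans k1; rewrite mulr_ge0// ltW.
apply: (le_trans (skeleton_upper HX i th0 (h0 n) n.+1)).
by rewrite lerD2l ler_wpM2r ?v_ge0// [leRHS]mulrA ler_wpM2r// sum_ge0.
Qed.

Let u_lower t : 0 < t -> 1 + kappa * G t * u t <= u (t + t).
Proof.
move=> t0.
have h0 n : 0 < t / n.+1%:R by rewrite divr_gt0.
pose lhs n := 1 + kappa *
  (t / n.+1%:R * \sum_(j < n.+1) p (t / n.+1%:R * j.+1%:R)) *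
  v (t / n.+1%:R) n.+1.
have lhs_cvg : lhs n @[n --> \oo] --> 1 + kappa * G t * u t.
  apply: cvgD; first exact: cvg_cst.
  apply: cvgM; last exact: v_cvg.
  by apply: cvgM; [exact: cvg_cst|exact: G_cvg].
(* Doubling the number of cells at mesh [t / n.+1] gives the partition of [[0, t + t]] into
   [(n.+1 + n).+1] cells, hence a subsequence of [v_cvg] at [t + t]. *)
have rhs_cvg : v (t / n.+1%:R) (n.+1 + n.+1) @[n --> \oo] --> u (t + t).
  have tt0 : 0 < t + t by rewrite addr_gt0.
  have oo : n.+1 + n @[n --> \oo] --> \oo.
    apply/cvgnyPge => A; near=> n.
    rewrite (@leq_trans n)//; first by near: n; exact: nbhs_infty_ge.
    by rewrite leq_addl.
  have := cvg_comp _ _ oo (v_cvg tt0).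
  apply: cvg_trans; apply: near_eq_cvg; apply: nearW => n /=.
  rewrite -addnS; congr (v _ _); rewrite natrD.
  have : n.+1%:R != 0 :> R by rewrite pnatr_eq0.
  move: n.+1%:R => N N0; field.
  by rewrite N0/= -mulr2n mulrn_eq0.
apply: (ler_cvg_to lhs_cvg rhs_cvg); apply: nearW => n.
have /andP[k1 k2] := theta_bounds (h0 n).
have th0 : 0 <= expR (kappa * (t / n.+1%:R)) - 1.
  by apply: le_trans k1; rewrite mulr_ge0// ltW.
apply: le_trans (skeleton_lower HX i th0 (h0 n) n.+1).
by rewrite lerD2l ler_wpM2r ?v_ge0// [leLHS]mulrA ler_wpM2r// sum_ge0.
Unshelve. all: by end_near.
Qed.

(** * The Green function and the limit of large times *)

Let p_int t : (@lebesgue_measure R).-integrable `[0, t] (EFin \o p).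
Proof.
apply: (@bounded_integrable _ _ _ _ _ _ 1) => //.
- exact: lebesgue_measure_bounded_itv_lty.
- apply: right_continuous_measurable => r.
  exact: transition_prob_right_continuous.
- by move=> r /=; rewrite in_itv/= => /andP[r0 _]; exact: p_le1.
Qed.

Let green_bigcup : green P X i =
  (\int[lebesgue_measure]_(t in \bigcup_n `[0%R, n%:R]%classic) (p t)%:E)%E.
Proof.
rewrite /green itv_bndy_bigcup_BRight.
by under eq_bigcupr do rewrite add0r.
Qed.

Let green_cvg : green P X i \is a fin_num ->
  G n%:R @[n --> \oo] --> fine (green P X i).
Proof.
move=> gfin; apply: fine_cvg; rewrite fineK// green_bigcup.
apply: ge0_nondecreasing_set_cvg_integral => //.
- move=> m n mn; apply/subsetPset => r /=; rewrite !in_itv/= => /andP[-> rm] /=.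
  by rewrite (le_trans rm)// ler_nat.
- by move=> n; have /integrableP[] := p_int n%:R.
- by move=> n r _; rewrite lee_fin fine_ge0.
Qed.

Hypothesis kappa_lt : (kappa%:E < (green P X i)^-1)%E.

Let green_ge0 : (0 <= green P X i)%E.
Proof. by apply: integral_ge0 => t _; rewrite lee_fin fine_ge0. Qed.

(** An infinite Green function has inverse 0, which is incompatible with [0 < kappa]. *)
Let green_fin : green P X i \is a fin_num.
Proof.
rewrite ge0_fin_numE// ltey; apply/eqP => goo.
by move: kappa_lt; rewrite goo invey lte_fin ltNge ltW.
Qed.

Let g := fine (green P X i).

Lemma kappa_green_lt1 : kappa * fine (green P X i) < 1.
Proof.
rewrite -/g.
move: kappa_lt; rewrite -(fineK green_fin) -/g inver.
(* The inverse of 0 in the extended reals is [+oo], so [g = 0] is treated apart. *)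
have [->|g0] := eqVneq g 0; first by rewrite mulr0.
have gp : 0 < g by rewrite lt_neqAle eq_sym g0 fine_ge0.
by rewrite lte_fin -(ltr_pM2r gp) mulVf.
Qed.

Let G_le t : G t <= g.
Proof.
apply: fine_le => //; first by apply: integrable_fin_num => //; exact: p_int.
apply: ge0_subset_integral => //.
- rewrite itv_bndy_bigcup_BRight; apply/measurable_fun_bigcup => // n.
  by have /integrableP[] := p_int (0 + n%:R).
- by move=> r _; rewrite lee_fin fine_ge0.
- by move=> r /=; rewrite !in_itv/= => /andP[-> _].
Qed.

Let u_le t : u t <= (1 - kappa * g)^-1.
Proof.
have kg : 0 < 1 - kappa * g by rewrite subr_gt0; exact: kappa_green_lt1.
have t1 : 0 < `|t| + 1 by rewrite ltr_pwDr.
(* Monotonicity moves to a positive time, where [u_upper] applies; then u <= 1 + kappa g u is solved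
   for u. *)
apply: (@le_trans _ _ (u (`|t| + 1))).
  by apply: u_nondecreasing; rewrite (le_trans (ler_norm _))// lerDl.
rewrite -[leRHS]mul1r ler_pdivlMr// mulrBr mulr1 lerBlDr.
apply: (le_trans (u_upper t1)); rewrite lerD2l mulrC ler_wpM2l//.
by rewrite ler_pM2l.
Qed.

Lemma exp_local_time_cvg : u t @[t --> +oo] --> (1 - kappa * g)^-1.
Proof.
have kg : 0 < 1 - kappa * g by rewrite subr_gt0; exact: kappa_green_lt1.
have ubu : has_ubound (range u).
  by exists (1 - kappa * g)^-1 => _ [t _ <-]; exact: u_le.
have ucvg := nondecreasing_cvgr u_nondecreasing ubu.
set U := sup _ in ucvg.
have un : u n%:R @[n --> \oo] --> U.
  by apply: cvg_comp ucvg; exact: cvgr_idn.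
have u2n : u (n%:R + n%:R) @[n --> \oo] --> U.
  have oo : n + n @[n --> \oo] --> \oo.
    apply/cvgnyPge => A; near=> n.
    rewrite (@leq_trans n)//; first by near: n; exact: nbhs_infty_ge.
    by rewrite leq_addl.
  have := cvg_comp _ _ oo un.
  by apply: cvg_trans; apply: near_eq_cvg; apply: nearW => n /=; rewrite natrD.
have rhs : 1 + kappa * G n%:R * u n%:R @[n --> \oo] --> 1 + kappa * g * U.
  apply: cvgD; first exact: cvg_cst.
  apply: cvgM; last exact: un.
  by apply: cvgM; [exact: cvg_cst|exact: (green_cvg green_fin)].
have Ule : U <= 1 + kappa * g * U.
  apply: (ler_cvg_to un rhs); near=> n; apply: u_upper; rewrite ltr0n.
  by near: n; exact: nbhs_infty_gt.
have Uge : 1 + kappa * g * U <= U.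
  apply: (ler_cvg_to rhs u2n); near=> n; apply: u_lower; rewrite ltr0n.
  by near: n; exact: nbhs_infty_gt.
(* Together [Ule] and [Uge] say that (1 - kappa g) U = 1. *)
rewrite (_ : _^-1 = U)//; apply: (mulfI (lt0r_neq0 kg)).
by rewrite divff ?lt0r_neq0// mulrBl mul1r; lra.
Unshelve. all: by end_near.
Qed.

End occupation.

Theorem proposition3p11 (R : realType) (d : measure_display)
    (Omega : measurableType d) (S : countType)
    (P : S -> probability Omega R) (X : R -> Omega -> S)
    (HX : is_ctmc P X) (i : S) (c alpha : R) (c_gt0 : 0 < c)
    (alpha_gt0 : 0 < alpha)
    (Hp : asymp_equiv (fun t => transition_prob P X t i i)
                      (fun t => c * t `^ (- alpha)))
    (kappa : R) (kappa_gt0 : 0 < kappa)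
    (kappa_lt : (kappa%:E < (green P X i)^-1)%E) :
  asymp_equiv
    (fun t => fine ('E_(P i)[fun w => expR (kappa * local_time X i t w)])%E)
    (fun _ => 1 / (1 - kappa * fine (green P X i))).
Proof.
have kg : 1 - kappa * fine (green P X i) != 0.
  by rewrite gt_eqF// subr_gt0 kappa_green_lt1.
have := exp_local_time_cvg HX kappa_gt0 kappa_lt.
rewrite /asymp_equiv unlock mul1r.
(* Dividing by the inverse of the constant is multiplying by the constant, which brings the limit to
   1. *)
move=> /(cvgM (cvg_cst (1 - kappa * fine (green P X i)))).
rewrite divff//; apply: cvg_trans; apply: near_eq_cvg; apply: nearW => t.
by rewrite invrK [RHS]mulrC.
Qed.
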